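(* Let $L$ be a QWRN compact space, let $K$ be a compact space, and let $f:L\to K$ be a continuous surjection. Then $K$ is QWRN.
   Context: Compact spaces are Hausdorff. A sequence $(A_n^0,A_n^1)_{n\in\mathbb{N}}$ of disjoint pairs of subsets of a set $S$ (i.e. $A_n^0\cap A_n^1=\emptyset$) is independent if for every $n\in\mathbb{N}$ and every $\varepsilon:\{1,\dots,n\}\to\{0,1\}$ we have $\bigcap_{k=1}^nA_k^{\varepsilon(k)}\neq\emptyset$. A family $(A_\alpha^0,A_\alpha^1)_{\alpha\in I}$ of disjoint pairs contains an independent sequence if there is a sequence $(\alpha_n)_{n\in\mathbb{N}}$ in $I$ such that $(A_{\alpha_n}^0,A_{\alpha_n}^1)_{n\in\mathbb{N}}$ is independent. A compact space $K$ is quasi WRN (QWRN) if there exist a set $\Gamma$ and a homeomorphic embedding of $K$ in $[0,1]^\Gamma$ such that for every $\varepsilon>0$ there exists a decomposition $\Gamma=\bigcup_{n\in\mathbb{N}}\Gamma_n^\varepsilon$ such that for all reals $p<q$ with $q-p>\varepsilon$ and every $n\in\mathbb{N}$, the family of pairs $(A_\alpha^0,A_\alpha^1)_{\alpha\in\Gamma_n^\varepsilon}$ does not contain independent sequences, where $A_\alpha^0=\{x\in K:x_\alpha<p\}$, $A_\alpha^1=\{x\in K:x_\alpha>q\}$, and $x_\alpha$ denotes the $\alpha$-th coordinate of the image of $x$ under the embedding. *)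

(* Defs.v *)
From HB Require Import structures.
From mathcomp Require Import all_boot all_order all_algebra.
From mathcomp Require Import all_classical all_reals all_analysis.

Set Implicit Arguments.
Unset Strict Implicit.
Unset Printing Implicit Defensive.

Import Order.TTheory GRing.Theory Num.Theory.
Import numFieldNormedType.Exports.

Local Open Scope classical_set_scope.
Local Open Scope ring_scope.

Definition compact_space (T : topologicalType) : Prop :=
  compact [set: T] /\ hausdorff_space T.

(* A pair (P^0, P^1) of subsets of S is a map P : bool -> set S, with
   P^0 = P false and P^1 = P true. *)
Definition disjoint_pair (S : Type) (P : bool -> set S) : Prop :=
  P false `&` P true = set0.

(* Sequences are indexed from 0, so 'I_n plays the role of {1, ..., n}. *)
Definition independent_pairs (S : Type) (A : nat -> bool -> set S) : Prop :=
  (forall n, disjoint_pair (A n)) /\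
  forall (n : nat) (eps : 'I_n -> bool),
    \bigcap_(k : 'I_n) A k (eps k) !=set0.

Definition contains_independent (S I : Type) (D : set I)
    (A : I -> bool -> set S) : Prop :=
  exists alpha : nat -> I,
    (forall n, D (alpha n)) /\ independent_pairs (fun n => A (alpha n)).

(* A homeomorphism onto its image, the image having the subspace topology. *)
Definition homeomorphic_embedding (T U : topologicalType) (e : T -> U) : Prop :=
  [/\ injective e, continuous e &
      forall V : set T, open V ->
        exists2 W : set U, open W & e @` V = W `&` range e].

(* [0, 1] with its subspace topology. *)
Definition unit_interval (R : realType) : topologicalType :=
  set_type (`[0, 1]%classic : set R).

Definition cube (R : realType) (Gamma : Type) : topologicalType :=
  {ptws Gamma -> unit_interval R}.

Definition cube_coord (R : realType) (Gamma : Type) (x : cube R Gamma)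
    (a : Gamma) : R := set_val (x a).

Definition coord_pair (R : realType) (K : topologicalType) (Gamma : Type)
    (e : K -> cube R Gamma) (p q : R) (a : Gamma) (i : bool) : set K :=
  if i then [set x | q < cube_coord (e x) a] else [set x | cube_coord (e x) a < p].

Definition QWRN (R : realType) (K : topologicalType) : Prop :=
  exists (Gamma : Type) (e : K -> cube R Gamma),
    homeomorphic_embedding e /\
    forall eps : R, 0 < eps ->
      exists G : nat -> set Gamma,
        \bigcup_n G n = [set: Gamma] /\
        forall p q : R, p < q -> eps < q - p ->
          forall n : nat, ~ contains_independent (G n) (coord_pair e p q).

(* Main.v *)
(* K is embedded in the cube over all continuous g : K -> [0, 1].  For compact
   L, each g \o f is controlled up to eps by finitely many coordinates of L read
   up to 3 / (N + 1); grouping the g's by N and by the pieces (of the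
   decomposition of Gamma for 1 / (N + 1)) that contain these coordinates gives
   countably many classes.  Suppose a class contained an independent sequence
   (g m).  By Rosenthal's dichotomy applied to the grid pairs
   (j / (N + 1), (j + 2) / (N + 1)), along some infinite M every point of L
   eventually stays on one side of each pair, for each of the finitely many
   controlling coordinates of g m; this gives finitely many types of points.
   By compactness there are infinitely many points x r of L such that for any
   r <> s the values g m (f (x r)) and g m (f (x s)) are separated by [p, q] for
   infinitely many m in M.  Two of these points have the same type, so their
   controlling coordinates are eventually 3 / (N + 1)-close along M, whence
   g m \o f differs by at most eps < q - p at these points: a contradiction. *)
Require Import Defs.
From HB Require Import structures.
From mathcomp Require Import all_boot all_order all_algebra.
From mathcomp Require Import all_classical all_reals all_analysis.
From mathcomp Require Import lra zify.
Import numFieldNormedType.Exports.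
Local Open Scope classical_set_scope.
Local Open Scope ring_scope.

Set Implicit Arguments.
Unset Strict Implicit.
Unset Printing Implicit Defensive.
Import Order.TTheory GRing.Theory Num.Theory.

(** * Infinite sets of indices *)

Definition unbounded_nat (M : set nat) : Prop :=
  forall n, exists2 m, (n <= m)%N & M m.

Lemma pigeonhole_unbounded (T : finType) (c : nat -> T) :
  exists t, unbounded_nat [set n | c n = t].
Proof.
apply: contrapT => /forallNP nub.
have bd t : exists n, forall m, (n <= m)%N -> c m <> t.
  apply: contrapT => /forallNP nb; apply: (nub t) => n.
  apply: contrapT => /forall2NP nm; apply: (nb n) => m nlem cm.
  by case: (nm m).
have [b bP] := choice bd.
pose n := \max_(t : T) b t.
by apply: (bP (c n) n) => //; exact: (leq_bigmax (c n)).
Qed.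

Lemma enumerate_unbounded (M : set nat) : unbounded_nat M ->
  exists phi : nat -> nat,
    {homo phi : m n / (m < n)%N} /\ forall n, M (phi n).
Proof.
move=> uM; have next n : exists m, (n < m)%N /\ M m.
  by have [m nm Mm] := uM n.+1; exists m.
have [h hP] := choice next.
exists (fun n => iter n.+1 h 0%N); split; last first.
  by move=> n; case: (hP (iter n h 0%N)).
apply: homo_ltn => [m n p|n]; first exact: ltn_trans.
by case: (hP (iter n.+1 h 0%N)).
Qed.

Lemma leq_increasing (phi : nat -> nat) :
  {homo phi : m n / (m < n)%N} -> forall n, (n <= phi n)%N.
Proof.
move=> incr; elim=> // n IHn; exact: leq_ltn_trans IHn (incr _ _ (ltnSn n)).
Qed.

(** * Rosenthal's dichotomy for sequences of disjoint pairs *)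

Section Rosenthal.
Variables (S : Type) (A : nat -> bool -> set S).

(** The convergent alternative: the avoided side [bn.1] and the threshold [bn.2] may depend on the
    point. *)
Definition settled (M : set nat) (X : set S) : Prop :=
  forall x, X x ->
    exists bn : bool * nat, forall m, M m -> (bn.2 <= m)%N -> ~ A m bn.1 x.

Definition unsettled (M : set nat) (X : set S) : Prop :=
  forall M', M' `<=` M -> unbounded_nat M' -> ~ settled M' X.

(* If every j failed on some cell X t `&` A j b, a diagonal set of such j's
   sharing the same (t, b) would be settled on X t. *)
Lemma unsettled_split (T : finType) (X : T -> set S) (M : set nat) :
    unbounded_nat M -> (forall t, unsettled M (X t)) ->
  exists j M', [/\ M j, M' `<=` M, unbounded_nat M' &
    forall tb : T * bool, unsettled M' (X tb.1 `&` A j tb.2)].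
Proof.
move=> uM unsX; apply: contrapT => nsplit.
have fail j (M' : set nat) : M j -> M' `<=` M -> unbounded_nat M' ->
    exists (tb : T * bool) M'',
      [/\ M'' `<=` M', unbounded_nat M'' & settled M'' (X tb.1 `&` A j tb.2)].
  move=> Mj M'M uM'; apply: contrapT => none; apply: nsplit.
  exists j, M'; split=> // tb M'' M''M' uM'' stl.
  by apply: none; exists tb, M''.
pose St := {N : set nat | N `<=` M /\ unbounded_nat N}.
have next (s : St) : exists r : nat * (T * bool) * St,
    [/\ sval s r.1.1, sval r.2 `<=` sval s,
        forall m, sval r.2 m -> (r.1.1 < m)%N &
        settled (sval r.2) (X r.1.2.1 `&` A r.1.1 r.1.2.2)].
  case: s => N [NM uN] /=; have [j _ Nj] := uN 0%N.
  (* Only indices above [j] are kept, so that the diagonal sequence increases strictly. *)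
  have uN' : unbounded_nat [set m | N m /\ (j < m)%N].
    move=> n; have [m nm Nm] := uN (maxn n j.+1).
    by exists m; [lia | split=> //; lia].
  have [||//|tb [M'' [M''N' uM'' stl]]] := fail j [set m | N m /\ (j < m)%N].
  - exact: NM.
  - by move=> m [/NM].
  have M''M : M'' `<=` M by move=> m /M''N' [/NM].
  exists (j, tb, exist _ M'' (conj M''M uM'')); split=> //= m /M''N' [] //.
have [step stepP] := choice next.
pose st n := iter n (fun s => (step s).2)
  (exist _ M (conj (@subset_refl _ M) uM) : St).
pose j n := (step (st n)).1.1; pose c n := (step (st n)).1.2.
have stS n k : sval (st (n + k)%N) `<=` sval (st n).
  elim: k => [|k IHk]; first by rewrite addn0.
  rewrite addnS => m /= Sm; apply: IHk.
  by case: (stepP (st (n + k)%N)) => _ + _ _; exact.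
have stj n : sval (st n) (j n) by case: (stepP (st n)).
have jS : {homo j : m n / (m < n)%N}.
  apply: homo_ltn => [x y z|n]; first exact: ltn_trans.
  by case: (stepP (st n)) => _ _ + _; apply; exact: (stj n.+1).
have [t ut] := pigeonhole_unbounded c.
apply: (unsX t.1 (j @` [set n | c n = t])).
- move=> _ [n _ <-]; have := stj n; rewrite -(add0n n).
  exact: stS.
- move=> n; have [m nm cm] := ut n; exists (j m); last by exists m.
  exact: leq_trans nm (leq_increasing jS m).
(* If [x] is on side [t.2] at some chosen [j n], it lies in the cell settled at step [n], and all
   later chosen indices belong to that settling set; otherwise [x] avoids side [t.2] throughout. *)
move=> x Xx; have [[n cn Anx]|none] :=
    pselect (exists2 n, c n = t & A (j n) t.2 x); last first.
  exists (t.2, 0%N) => _ [n cn <-] _ Anx; apply: none; by exists n.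
have [_ _ _ /(_ x)] := stepP (st n); rewrite -/(j n) -/(c n) cn.
case=> [//|[b k] bkP].
exists (b, maxn k (j n).+1) => /= _ [m cm <-]; rewrite geq_max => /andP[kj jnm].
apply: bkP => //=; have nm : (n < m)%N.
  case: (ltngtP n m) jnm => // [/jS|->]; lia.
have := stj m; rewrite -(subnKC nm); exact: (stS n.+1).
Qed.

(** If no infinite subset of [M] is settled, repeated splitting of the single cell [setT] yields
    indices for which every finite sign pattern has an unsettled cell: an independent sequence. *)
Lemma rosenthal_dichotomy (M : set nat) :
    (forall m, disjoint_pair (A m)) -> unbounded_nat M ->
    ~ contains_independent setT A ->
  exists2 M', M' `<=` M & unbounded_nat M' /\ settled M' setT.
Proof.
move=> disjA uM nind; apply: contrapT => /forall2NP nset.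
pose St := {TXM : {T : finType & T -> set S} * set nat |
  unbounded_nat TXM.2 /\ forall t, unsettled TXM.2 (projT2 TXM.1 t)}.
have next (s : St) : exists r : nat * St, exists g :
    projT1 (sval s).1 * bool -> projT1 (sval r.2).1,
    forall tb, projT2 (sval r.2).1 (g tb) =
      projT2 (sval s).1 tb.1 `&` A r.1 tb.2.
  case: s => -[[T X] N] [/= uN unsX].
  have [j [N' [_ _ uN' unsN']]] := unsettled_split uN unsX.
  pose X' (tb : T * bool) := X tb.1 `&` A j tb.2.
  by exists (j, exist _ (existT (fun T : finType => T -> set S)
    (T * bool)%type X', N') (conj uN' unsN')); exists id.
have [step stepP] := choice next.
have s0P : unbounded_nat M /\
    forall t : unit, unsettled M ((fun _ : unit => setT) t).
  split=> // _ M' M'M uM' stl; case: (nset M') => //; exact.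
pose s0 : St := exist _ (existT (fun T : finType => T -> set S)
  unit (fun=> setT), M) s0P.
pose st n := iter n (fun s => (step s).2) s0.
pose j n := (step (st n)).1.
apply: nind; exists j; split=> //; split=> [n|n eps]; first exact: disjA.
(* Every cell stays unsettled, hence nonempty: the empty set is settled. *)
have cell (e : nat -> bool) : exists t, projT2 (sval (st n)).1 t `<=`
    [set x | forall k, (k < n)%N -> A (j k) (e k) x].
  elim: n {eps} => [|n [t IHt]]; first by exists tt.
  have [g gP] := stepP (st n); exists (g (t, e n)) => x.
  rewrite /= gP => -[/IHt Hx Ax] k; rewrite ltnS leq_eqVlt => /orP[/eqP->//|].
  exact: Hx.
(* [eps] is extended by [false] from [n] on; only its values below [n] matter. *)
have [t tP] := cell (fun k => if insub k is Some i then eps i else false).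
have [uN unsN] := svalP (st n).
have [x Xx] : projT2 (sval (st n)).1 t !=set0.
  apply/set0P/eqP => X0; apply: (unsN t (sval (st n)).2) => // x.
  by rewrite X0.
exists x => i _; have := tP x Xx i (ltn_ord i).
by case: insubP => [i' _ /val_inj ->//|]; rewrite ltn_ord.
Qed.

End Rosenthal.

(** Settledness passes to smaller index sets, so the dichotomy can be applied to one member of [I]
    after another. *)
Lemma simultaneously_settled (S : Type) (I : finType)
    (A : I -> nat -> bool -> set S) :
    (forall i m, disjoint_pair (A i m)) ->
    (forall i, ~ contains_independent setT (A i)) ->
  exists2 M, unbounded_nat M & forall i, settled (A i) M setT.
Proof.
move=> disjA nind.
suff H (s : seq I) : exists2 M, unbounded_nat M &
    forall i, i \in s -> settled (A i) M setT.
  have [M uM MP] := H (enum I); exists M => // i.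
  by apply: MP; rewrite mem_enum.
elim: s => [|i s [M uM MP]]; first by exists setT => // n; exists n.
have [M' M'M [uM' stl]] := rosenthal_dichotomy (disjA i) uM (nind i).
exists M' => // k; rewrite in_cons => /orP[/eqP->//|/MP stlk] x Xx.
by have [bn bnP] := stlk x Xx; exists bn => m /M'M; exact: bnP.
Qed.

(** * Compactness and control by finitely many coordinates *)

Lemma compact_finite_cover (T : topologicalType) (I : Type) (U : I -> set T) :
    compact [set: T] -> (forall x : T, exists i, nbhs x (U i)) ->
  exists s : seq {classic I}, forall x, exists2 i, i \in s & U i x.
Proof.
move=> cT cov.
pose F := filter_from setT
  (fun s0 : seq {classic I} => [set s : seq {classic I} | {subset s0 <= s}]).
have FF : Filter F.
  apply: filter_from_filter; first by exists [::].
  move=> s1 s2 _ _; exists (s1 ++ s2) => // s s12.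
  by split=> i si; apply: s12; rewrite mem_cat si ?orbT.
have [x _|s0 _ sP] := (compact_near_coveringP _).1 cT _ F
    (fun s x => exists2 i, i \in s & U i x) FF.
  have [i xUi] := cov x.
  exists (U i, [set s : seq {classic I} | {subset [:: i : {classic I}] <= s}]).
    by split=> //; exists [:: i : {classic I}].
  by move=> [y s] [/= Uiy si]; exists i => //; apply: si; rewrite mem_head.
by exists s0 => x; apply: sP.
Qed.

Section Coordinates.
Variables (R : realType) (L : topologicalType) (Gamma : Type).
Variable e : L -> cube R Gamma.

Lemma coord_pair_disjoint (p q : R) (a : Gamma) :
  p <= q -> disjoint_pair (coord_pair e p q a).
Proof.
move=> pq; apply/seteqP; split=> // x [/= xp qx].
by move: (lt_le_trans xp pq) (lt_trans qx xp); lra.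
Qed.

Lemma cube_coord_range (x : cube R Gamma) (a : Gamma) :
  0 <= cube_coord x a <= 1.
Proof. by have := set_valP (x a); rewrite /= in_itv. Qed.

Lemma cube_coord_continuous (a : Gamma) : continuous e ->
  continuous (fun x => cube_coord (e x) a).
Proof.
move=> ce x; apply: (@continuous_comp _ _ _ (fun x => e x a)
  (set_val : unit_interval R -> R)); last exact: initial_continuous.
apply: (@continuous_comp _ _ _ e (fun z : cube R Gamma => z a)).
  exact: ce.
exact: (@proj_continuous {classic Gamma} (fun=> unit_interval R) a).
Qed.

(** [L * L] is covered by the open set where [u] varies by less than [eps] and, since [e] is
    injective, the open sets where one coordinate varies by more than some [3 / N.+1]. A finite
    subcover lists the coordinates, and its largest [N] gives the strictest threshold. *)
Lemma finitely_many_coords_modulus (u : L -> R) (eps : R) :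
    compact [set: L] -> injective e -> continuous e -> continuous u ->
    0 < eps ->
  exists (s : seq {classic Gamma}) (N : nat), forall x y,
    (forall a, a \in s ->
      `|cube_coord (e x) a - cube_coord (e y) a| <= 3 / N.+1%:R) ->
    `|u x - u y| <= eps.
Proof.
move=> cL ie ce cu eps0.
have cLL : compact [set: L * L] by rewrite -setXTT; exact: compact_setX.
have diff_cvg (v : L -> R) (x y : L) : continuous v ->
    `|v z.1 - v z.2| @[z --> (x, y)] --> `|v x - v y|.
  move=> cv; apply: cvg_norm; apply: cvgB.
    by apply: (@cvg_comp _ _ _ fst v _ (nbhs x)); [exact: cvg_fst | exact: cv].
  by apply: (@cvg_comp _ _ _ snd v _ (nbhs y)); [exact: cvg_snd | exact: cv].
pose U (i : option (Gamma * nat)) : set (L * L) := if i is Some aN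
  then [set z | 3 / aN.2.+1%:R <
    `|cube_coord (e z.1) aN.1 - cube_coord (e z.2) aN.1|]
  else [set z | `|u z.1 - u z.2| < eps].
have [[x y]|s sP] := compact_finite_cover (U := U) cLL.
  have [ult|uge] := ltP `|u x - u y| eps.
    by exists None; exact: cvgr_lt _ (diff_cvg u x y cu) _ ult.
  have exy : e x <> e y.
    by move=> /ie xy; move: uge; rewrite xy subrr normr0; lra.
  have [a axy] : exists a, cube_coord (e x) a != cube_coord (e y) a.
    apply: contrapT => /forallNP eqa; apply: exy; apply/funext => a.
    apply: val_inj; apply/eqP; have /negP := eqa a; rewrite negbK.
    by rewrite /cube_coord !set_valE.
  have d0 : 0 < `|cube_coord (e x) a - cube_coord (e y) a|.
    by rewrite normr_gt0 subr_eq0.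
  have [N NP] : exists N : nat,
      3 / N.+1%:R < `|cube_coord (e x) a - cube_coord (e y) a|.
    set d := `|_| in d0 *; exists (Num.truncn (3 / d)).
    by rewrite ltr_pdivrMr ?ltr0n// mulrC -ltr_pdivrMr// truncnS_gt.
  exists (Some (a, N)).
  have := diff_cvg _ x y (@cube_coord_continuous a ce).
  by move/cvgr_gt; apply.
pose coord_of (i : {classic option (Gamma * nat)}) : option {classic Gamma} :=
  omap fst i.
pose bound_of (i : {classic option (Gamma * nat)}) : nat :=
  if i is Some aN then aN.2 else 0%N.
exists (pmap coord_of s), (\max_(i <- s) bound_of i) => x y sxy.
have [[[a N]|] si] := sP (x, y); last exact: ltW.
rewrite /U /= ltNge => /negP[]; apply: le_trans (sxy a _) _.
  by rewrite mem_pmap; apply/mapP; exists (Some (a, N)).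
rewrite ler_pM2l// lef_pV2 ?posrE ?ltr0n// ler_nat ltnS.
exact: (@leq_bigmax_seq _ s xpredT bound_of (Some (a, N))).
Qed.
End Coordinates.

(** * Finitely many types of points exclude free sequences *)

Lemma not_separated_close (R : realType) (N : nat) (s t : R) :
    0 <= s -> t <= 1 ->
    (forall j : 'I_N.+1, exists b : bool,
      [/\ if b then s <= j.+2%:R / N.+1%:R else j%:R / N.+1%:R <= s &
          if b then t <= j.+2%:R / N.+1%:R else j%:R / N.+1%:R <= t]) ->
  t - s <= 3 / N.+1%:R.
Proof.
move=> s0 t1 sep; have N0 : 0 < N.+1%:R :> R by rewrite ltr0n.
rewrite leNgt; apply/negP; rewrite ltr_pdivrMr// mulrBl => gap.
have tN : t * N.+1%:R <= N.+1%:R by rewrite ler_piMl// ltW.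
have sN0 : 0 <= s * N.+1%:R by rewrite mulr_ge0// ltW.
have /andP[lo hi] := truncn_itv sN0.
set j := Num.truncn _ in lo hi.
have jN : (j.+1 < N.+1)%N by rewrite -(ltr_nat R) -natr1; lra.
(* Here [s < j.+1 / N.+1] and [j.+3 / N.+1 < t], so the grid pair of index [j.+1] strictly separates
   [s] from [t]. *)
have [[] /= [sj tj]] := sep (Ordinal jN).
  move: tj; rewrite ler_pdivlMr// -!natr1 => tj; lra.
by move: sj; rewrite ler_pdivrMr// leNgt hi.
Qed.

Lemma pigeonhole_pair (T : finType) (c : nat -> T) :
  exists rs : nat * nat, rs.1 <> rs.2 /\ c rs.1 = c rs.2.
Proof.
have [t ut] := pigeonhole_unbounded c.
have [r _ cr] := ut 0%N; have [s rs cs] := ut r.+1.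
by exists (r, s) => /=; split; [lia | rewrite cr cs].
Qed.

(** Freeness is stated for infinite sign patterns with non-strict inequalities, the form in which
    compactness delivers it from independence. *)
Lemma no_free_sequence (R : realType) (L : topologicalType) (Gamma : Type)
    (e : L -> cube R Gamma) (N k : nat) (H : 'I_k -> set Gamma)
    (h : nat -> L -> R) (gamma : nat -> 'I_k -> Gamma) (eps p q : R) :
    (forall i p q, p < q -> N.+1%:R^-1 < q - p ->
      ~ contains_independent (H i) (coord_pair e p q)) ->
    (forall m i, H i (gamma m i)) ->
    (forall m x y,
      (forall i, `|cube_coord (e x) (gamma m i) - cube_coord (e y) (gamma m i)|
         <= 3 / N.+1%:R) ->
      `|h m x - h m y| <= eps) ->
    eps < q - p ->
  ~ (forall sigma : nat -> bool,
      exists x, forall m, if sigma m then q <= h m x else h m x <= p).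
Proof.
move=> nind Hgamma ctrl epq free.
have N0 : 0 < N.+1%:R :> R by rewrite ltr0n.
pose lo (j : 'I_N.+1) : R := j%:R / N.+1%:R.
pose hi (j : 'I_N.+1) : R := j.+2%:R / N.+1%:R.
have gap j : hi j - lo j = 2 / N.+1%:R.
  by rewrite /hi /lo -mulrBl -natrB ?leqW// -addn2 addKn.
have lohi j : lo j < hi j by rewrite -subr_gt0 gap divr_gt0.
pose A (ij : 'I_k * 'I_N.+1) m :=
  coord_pair e (lo ij.2) (hi ij.2) (gamma m ij.1).
have [M uM stl] : exists2 M, unbounded_nat M & forall ij, settled (A ij) M setT.
  apply: simultaneously_settled => [[i j] m|[i j] [alpha [_ ind]]].
    exact/coord_pair_disjoint/ltW.
  apply: (nind i _ _ (lohi j)); last by exists (fun n => gamma (alpha n) i).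
  by rewrite gap -[ltLHS]mul1r ltr_pM2r ?invr_gt0//; lra.
have [phi [phiS phiM]] := enumerate_unbounded uM.
(* The sequences sigma r are indicators of disjoint unbounded subsets of M. *)
pose idx r b := (2 ^ r * b.*2.+1)%N; pose node r b := phi (idx r b).
have idxE r b : logn 2 (idx r b) = r.
  by rewrite lognM ?expn_gt0// pfactorK// lognE dvdn2 /= odd_double addn0.
have [x xP] := choice (fun r => free (fun m => `[< exists b, m = node r b >])).
have [c cP] := choice (fun rij : nat * ('I_k * 'I_N.+1) =>
  stl rij.2 (x rij.1) I).
(* The type of [x r] records, for each controlling coordinate and grid pair, a side eventually
   avoided along [M]. *)
have [[r s] /= [rs crs]] :=
  pigeonhole_pair (fun r => [ffun ij => (c (r, ij)).1]).
pose n0 := maxn (\max_ij (c (r, ij)).2) (\max_ij (c (s, ij)).2).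
(* This [b] reaches past all thresholds because [b <= idx r b <= phi (idx r b)]. *)
pose b := n0; have n0b : (n0 <= node r b)%N.
  apply: leq_trans (leq_increasing phiS _); rewrite /idx -/b.
  by have := expn_gt0 2 r; nia.
have close i : `|cube_coord (e (x r)) (gamma (node r b) i) -
    cube_coord (e (x s)) (gamma (node r b) i)| <= 3 / N.+1%:R.
  have sep (j : 'I_N.+1) : exists b' : bool, forall u, u = r \/ u = s ->
      let t := cube_coord (e (x u)) (gamma (node r b) i) in
      if b' then t <= hi j else lo j <= t.
    exists (c (r, (i, j))).1 => u urs.
    have cE : (c (r, (i, j))).1 = (c (u, (i, j))).1.
      by case: urs => -> //; have /ffunP/(_ (i, j)) := crs; rewrite !ffunE.
    have far : ((c (u, (i, j))).2 <= node r b)%N.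
      apply: leq_trans n0b; rewrite leq_max.
      by case: urs => ->;
        rewrite (leq_bigmax (F := fun ij => (c (_, ij)).2)) ?orbT.
    have := cP (u, (i, j)) (node r b) (phiM _) far.
    rewrite cE /A /coord_pair /=.
    by case: (c _).1 => /= notA; rewrite leNgt; apply/negP.
  have dist u v : u = r \/ u = s -> v = r \/ v = s ->
      cube_coord (e (x v)) (gamma (node r b) i) -
      cube_coord (e (x u)) (gamma (node r b) i) <= 3 / N.+1%:R.
    move=> urs vrs; apply: not_separated_close.
    - by have /andP[] := cube_coord_range (e (x u)) (gamma (node r b) i).
    - by have /andP[] := cube_coord_range (e (x v)) (gamma (node r b) i).
    - by move=> j; have [b' b'P] := sep j; exists b'; split; exact: b'P.
  by rewrite ler_norml lerNl opprB !dist//; by [left | right].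
(* At [m = node r b] the pattern of [x r] is [true] and that of [x s] is [false], so the values of
   [h m] differ by at least [q - p]. *)
have := ctrl _ _ _ close.
have := xP r (node r b); rewrite asboolT; last by exists b.
have := xP s (node r b); rewrite asboolF; last first.
  rewrite /node => -[b' rb].
  have : idx r b = idx s b'.
    by case: (ltngtP (idx r b) (idx s b')) => // /phiS; rewrite rb ltnn.
  by move/(congr1 (logn 2)); rewrite !idxE.
by move=> ? ?; rewrite ler_norml; lra.
Qed.

(** * Realizing infinite patterns, and the evaluation embedding *)

Lemma compact_realize (T : topologicalType) (C : nat -> set T) :
    compact [set: T] -> (forall n, closed (C n)) ->
    (forall n, exists x, forall m, (m < n)%N -> C m x) ->
  exists x, forall n, C n x.
Proof.
move=> cT clC fip; apply: contrapT => /forallNP none.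
have [x|s sP] := compact_finite_cover (U := fun n => ~` C n) cT.
  have /existsNP[n nC] := none x.
  by exists n; apply: open_nbhs_nbhs; split; [rewrite openC | ].
have [x xP] := fip (\max_(n <- s) n).+1.
have [n ns] := sP x; apply; apply: xP; rewrite ltnS.
exact: (@leq_bigmax_seq _ s xpredT id n).
Qed.

Definition unit_function (R : realType) (K : topologicalType) : Type :=
  {g : K -> unit_interval R | continuous g}.

Definition evaluation (R : realType) (K : topologicalType) (x : K) :
    cube R (unit_function R K) :=
  fun g => sval g x.

(** By Urysohn's lemma some function is 0 at [x] and 1 on [B]; the closed fibre over 1 contains the
    closure of the image of [B]. *)
Lemma unit_function_separates (R : realType) (K : topologicalType)
    (B : set K) (x : K) :
    compact_space K -> closed B -> ~ B x ->
  exists g : unit_function R K, ~ closure (sval g @` B) (sval g x).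
Proof.
move=> [cK hK] clB nBx.
have /(normal_completely_regular (R := R) (compact_normal hK cK)) :=
  hausdorff_accessible hK.
move=> /(_ x B clB nBx)/(uniform_separatorP (R := R)) [g [cg rg gx gB]].
have g01 y : g y \in (`[0, 1]%classic : set R) by apply/mem_set/rg; exists y.
pose h y : unit_interval R := exist _ (g y) (g01 y).
have ch : continuous h.
  apply/continuousP => U [V oV <-].
  by have /continuousP/(_ V oV) := cg.
exists (exist _ h ch) => /= clx.
have clone : closed [set z : unit_interval R | set_val z = 1].
  rewrite (_ : mkset _ = (set_val : unit_interval R -> R) @^-1` [set 1])//.
  apply: preimage_closed => [? _|]; first exact: initial_continuous.
  exact/accessible_closed_set1/hausdorff_accessible/Rhausdorff.
have hB1 : h @` B `<=` [set z : unit_interval R | set_val z = 1].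
  by move=> _ [y By <-] /=; apply: gB; exists y.
have := closureS hB1 clx; rewrite -(closure_id _).1 //= set_valE /=.
have -> : g x = 0 by apply: gx; exists x.
by apply/eqP; rewrite eq_sym oner_eq0.
Qed.

(** Continuous functions separating points from closed sets embed a T1 space in the product. *)
Lemma evaluation_embedding (R : realType) (K : topologicalType) :
  compact_space K -> homeomorphic_embedding (@evaluation R K).
Proof.
move=> cK; have aK : accessible_space K.
  by apply: hausdorff_accessible; case: cK.
pose I := {classic (unit_function R K)}.
have sep := fun B x => @unit_function_separates R K B x cK.
have cont (g : I) : continuous (sval g) := svalP g.
split.
- move=> x y exy; apply: (join_product_inj (I := I) sep aK) exy;
    exact: mem_setT.
- exact: (join_product_continuous (I := I) sep cont).
move=> V /(join_product_open (I := I) sep)/open_subspaceP [W oW WV].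
exists W => //; rewrite WV; apply/esym/setIidl.
exact: image_subset.
Qed.

(** * Continuous images of QWRN spaces *)

Theorem theorem2p6 (R : realType) (L K : topologicalType) (f : L -> K)
  (compL : compact_space L) (qwrnL : QWRN R L) (compK : compact_space K)
  (contf : continuous f) (surjf : set_surj [set: L] [set: K] f) :
  QWRN R K.
Proof.
have [Gamma [e [[inj_e cont_e _] dec]]] := qwrnL.
have decN (N : nat) := dec N.+1%:R^-1 ltac:(by rewrite invr_gt0 ltr0n).
have [H HP] := choice decN.
exists (unit_function R K), (@evaluation R K).
split; first exact: evaluation_embedding.
move=> eps eps0.
pose h (g : unit_function R K) (x : L) : R := set_val (sval g (f x)).
(* A class fixes the grid size and the numbers of the pieces, while the coordinates [gamma] vary
   with [g]. *)
pose G (Nns : nat * seq nat) := [set g : unit_function R K |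
  exists gamma : 'I_(size Nns.2) -> Gamma,
    (forall i : 'I_(size Nns.2), H Nns.1 (nth 0%N Nns.2 i) (gamma i)) /\
    forall x y, (forall i, `|cube_coord (e x) (gamma i) -
        cube_coord (e y) (gamma i)| <= 3 / Nns.1.+1%:R) ->
      `|h g x - h g y| <= eps].
(* The labels are countable; a number encoding no label gets the empty class. *)
exists (fun n => if unpickle n is Some Nns then G Nns else set0); split.
  apply/seteqP; split=> // g _.
  have cont_h : continuous (h g).
    move=> x; apply: (@continuous_comp _ _ _ f (fun z => set_val (sval g z))).
      exact: contf.
    apply: (@continuous_comp _ _ _ (sval g) (set_val : unit_interval R -> R)).
      exact: svalP g _.
    exact: initial_continuous.
  have [s [N sP]] :=
    finitely_many_coords_modulus compL.1 inj_e cont_e cont_h eps0.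
  have [idx idxP] : exists idx : Gamma -> nat, forall a, H N (idx a) a.
    have cov a : exists n, H N n a.
      by have : setT a by []; rewrite -(HP N).1 => -[n _ Hna]; exists n.
    by have [idx] := choice cov; exists idx.
  exists (pickle (N, map idx s)) => //; rewrite pickleK.
  pose gamma i := tnth (in_tuple s) (cast_ord (size_map idx s) i).
  exists gamma; split.
    move=> i /=; rewrite (nth_map (gamma i)) -?(size_map idx s)//.
    by rewrite -(tnth_nth _ (in_tuple s) (cast_ord (size_map idx s) i)).
  move=> x y /= sxy; apply: sP => a /(tnthP (in_tuple s)) [i ->].
  have := sxy (cast_ord (esym (size_map idx s)) i).
  by rewrite /gamma cast_ordKV.
move=> p q pq epq n [g [Gg [_ ind]]]; move: Gg.
case: (unpickle n) => [[N ns] Gg|/(_ 0%N)//].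
have [gamma gammaP] := choice Gg.
apply: (@no_free_sequence R L Gamma e N (size ns)
  (fun i => H N (nth 0%N ns i)) (fun m => h (g m)) gamma eps p q) => //.
- move=> i p' q' pq' gap; exact: (HP N).2.
- by move=> m i; case: (gammaP m).
- by move=> m x y; case: (gammaP m) => _; apply.
move=> sigma.
have cont_g m : continuous (fun z => cube_coord (@evaluation R K z) (g m)).
  by apply: cube_coord_continuous; case: (evaluation_embedding R compK).
(* Closed relaxations of the independence conditions: compactness realizes all of them at one point
   of [K], which [surjf] lifts to [L]. *)
pose C m := [set z : K | let t := cube_coord (@evaluation R K z) (g m) in
   if sigma m then q <= t else t <= p].
have [m|m|z zP] := @compact_realize K C compK.1.
- rewrite /C; case: (sigma m).
    exact: (preimage_closed (fun z _ => cont_g m z) (closed_ge (y := q))).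
  exact: (preimage_closed (fun z _ => cont_g m z) (closed_le (y := p))).
- have [z zP] := ind m (fun k => sigma k); exists z => k km.
  have := zP (Ordinal km) I; rewrite /C /coord_pair /=.
  by case: (sigma k) => /ltW.
have [x _ fx] := surjf z I; exists x => m; rewrite /h fx; exact: zP.
Qed.
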